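(* Let $T \in \mathcal{B}_{A}(\mathcal{H})$. Then the following inequalities hold: (i) for every $\alpha\in[0,1]$, $$\|T\|_{A_\alpha}^2 \leq \frac{\alpha}{2}w_{A}(T^2)+\left\|\frac{\alpha}{4}(T^{\sharp_A}T+TT^{\sharp_A})+(1-\alpha) T^{\sharp_A}T\right\|_{A};$$ (ii) $$w_{A}^2(T) \leq \min_{\alpha\in[0,1]} \left\{\frac{\alpha}{2}w_{A}(T^2)+\left\|\frac{\alpha}{4}(T^{\sharp_A}T+TT^{\sharp_A})+(1-\alpha) T^{\sharp_A}T\right\|_{A}\right\} \leq \frac{1}{2}w_{A}(T^2)+\frac{1}{4}\left\|T^{\sharp_A}T+TT^{\sharp_A}\right\|_A.$$
   Context: $\mathcal{H}$ is a complex Hilbert space with inner product $\langle\cdot,\cdot\rangle$, $\mathcal{B}(\mathcal{H})$ is the algebra of bounded linear operators on $\mathcal{H}$, and $A\in\mathcal{B}(\mathcal{H})$ is a fixed positive operator (self-adjoint with $\langle Ax,x\rangle\ge 0$ for all $x\in\mathcal{H}$). Put $\langle x,y\rangle_A=\langle Ax,y\rangle$ and $\|x\|_A=\sqrt{\langle x,x\rangle_A}=\|A^{1/2}x\|$. $R(\cdot)$ denotes range. Let $\mathcal{B}_A(\mathcal{H})=\{T\in\mathcal{B}(\mathcal{H}) : R(T^*A)\subseteq R(A)\}$, a subalgebra of $\mathcal{B}(\mathcal{H})$ whose elements $T$ are $A$-bounded (there is $c>0$ with $\|Tx\|_A\le c\|x\|_A$ for all $x\in\mathcal{H}$). For $T\in\mathcal{B}_A(\mathcal{H})$,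 $T^{\sharp_A}$ denotes the unique solution $X\in\mathcal{B}(\mathcal{H})$ of $AX=T^*A$ with $R(X)\subseteq\overline{R(A)}$; it again belongs to $\mathcal{B}_A(\mathcal{H})$. For an $A$-bounded operator $T$: - the $A$-operator semi-norm is $\|T\|_A=\sup\{\|Tx\|_A/\|x\|_A : x\in\overline{R(A)},\ x\ne 0\}$; - the $A$-numerical radius is $w_A(T)=\sup\{|\langle Tx,x\rangle_A| : x\in\mathcal{H},\ \|x\|_A=1\}$; - for $\alpha\in[0,1]$, $\|T\|_{A_\alpha}=\sup\left\{\sqrt{\alpha|\langle Tx,x\rangle_A|^2+(1-\alpha)\|Tx\|_A^2} : x\in\mathcal{H},\ \|x\|_A=1\right\}$. *)

(* Defs.v *)
From mathcomp Require Import all_boot all_order all_algebra.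
From mathcomp Require Import sesquilinear complex.
From mathcomp Require Import all_classical all_reals.
From mathcomp Require Import topology normedtype.

Set Implicit Arguments.
Unset Strict Implicit.
Unset Printing Implicit Defensive.

Import Order.TTheory GRing.Theory Num.Theory.
Import numFieldNormedType.Exports.

Local Open Scope classical_set_scope.
Local Open Scope ring_scope.
Local Open Scope complex_scope.

(* A complex Hilbert space is a complete normed module H over R[i] together
   with a positive definite hermitian form dot, linear in its first argument,
   such that `|x| ^+ 2 = dot x x; this last condition is [is_inner_product]. *)
Definition is_inner_product (R : realType) (H : completeNormedModType R[i])
    (dot : {dot H for Num.conj}) : Prop :=
  forall x : H, `|x| ^+ 2 = dot x x.

Section Operators.
Variables (R : realType) (H : completeNormedModType R[i]).
Variable dot : {dot H for Num.conj}.

Definition bounded_operator : set (H -> H) :=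
  [set T | linear T /\ exists c : R[i], forall x, `|T x| <= c * `|x|].

(* The value is the zero operator if no adjoint exists, which does not happen
   for a bounded operator on a Hilbert space. *)
Definition adjoint (T : H -> H) : H -> H :=
  xget (fun=> 0) [set S : H -> H | bounded_operator S /\
                           forall x y, dot (T x) y = dot x (S y)].

(* In R[i], 0 <= z says that z is real and nonnegative. *)
Definition positive_operator (A : H -> H) : Prop :=
  [/\ bounded_operator A, adjoint A = A & forall x, 0 <= dot (A x) x].

Section SemiHilbert.
Variable A : H -> H.

Definition dotA (x y : H) : R[i] := dot (A x) y.

(* dotA x x is real and nonnegative when A is positive; Re brings it to R. *)
Definition normA (x : H) : R := Num.sqrt (complex.Re (dotA x x)).

Definition BA : set (H -> H) :=
  [set T | bounded_operator T /\ range (adjoint T \o A) `<=` range A].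

(* The value is the zero operator if there is no such X, which does not happen
   when A is positive and T is in BA. *)
Definition sharpA (T : H -> H) : H -> H :=
  xget (fun=> 0) [set X : H -> H | [/\ bounded_operator X,
                           A \o X = adjoint T \o A &
                           range X `<=` closure (range A)]].

(* The three suprema below are finite when A is positive and T is A-bounded.
   If A = 0 they are taken over the empty set, and are then 0. *)
Definition opnormA (T : H -> H) : R :=
  sup [set normA (T x) / normA x | x in closure (range A) `\ 0].

Definition numradiusA (T : H -> H) : R :=
  sup [set ComplexField.Normc.normc (dotA (T x) x) | x in [set x | normA x = 1]].

Definition alphanormA (alpha : R) (T : H -> H) : R :=
  sup [set Num.sqrt (alpha * ComplexField.Normc.normc (dotA (T x) x) ^+ 2
                     + (1 - alpha) * normA (T x) ^+ 2)
      | x in [set x | normA x = 1]].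

End SemiHilbert.
End Operators.

Definition is_minimum (R : realType) (S : set R) (m : R) : Prop :=
  S m /\ lbound S m.

(* Main.v *)
Require Import Defs.
From mathcomp Require Import all_boot all_order all_algebra.
From mathcomp Require Import sesquilinear complex.
From mathcomp Require Import all_classical all_reals.
From mathcomp Require Import topology normedtype derive.
From mathcomp Require Import ring lra.

(* Buzano's inequality applied to T x, T^# x and x, all for the semi-inner
   product <A ., .>, gives, when |x|_A = 1,
     |<T x, x>_A|^2 <= |<T^2 x, x>_A| / 2 + (|T x|_A^2 + |T^# x|_A^2) / 4,
   and |T x|_A^2, |T^# x|_A^2 are the quadratic forms of T^# T and T T^# at x;
   this yields (i).  The bound is Lipschitz in alpha, hence attains its minimum
   on [0, 1], and it dominates w_A(T)^2 for every alpha.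

   The suprema are meaningful only because T^# exists and is bounded, and because
   T is A-bounded.  T^# x is the projection on the closure of R(A) of any z such
   that A z = T^* A x; it is bounded by the uniform boundedness principle applied
   to the vectors A T z with |A z| <= 1.  T is A-bounded because S = T^# T is
   symmetric for <A ., .>, so that k |-> |S^k x|_A is log-convex and grows at most
   like |S|^k, whence |S x|_A <= |S| |x|_A. *)

Set Implicit Arguments.
Unset Strict Implicit.
Unset Printing Implicit Defensive.

Import Order.TTheory GRing.Theory Num.Theory.
Import numFieldNormedType.Exports.

Local Open Scope classical_set_scope.
Local Open Scope ring_scope.
Local Open Scope complex_scope.

(* complex_scope reads z ^* as conjc, but {dot H for Num.conj} uses Num.conj. *)
Local Notation "z ^*" := (Num.conj z) : complex_scope.
Local Notation Re := complex.Re.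
Local Notation normc := ComplexField.Normc.normc.

(** * Semi-inner products *)

Section ComplexModulus.
Variable R : realType.
Implicit Types z : R[i].

Lemma real_normcE z : (normc z)%:C = `|z|.
Proof. by []. Qed.

Lemma normc_ge0 z : 0 <= normc z.
Proof. by rewrite -ler0c real_normcE. Qed.

Lemma normc_real (a : R) : normc a%:C = `|a|.
Proof. by rewrite /= expr0n addr0 sqrtr_sqr. Qed.

Lemma normc_conj z : normc z^* = normc z.
Proof. by apply: complexI; rewrite !real_normcE normcJ. Qed.

Lemma conj_realC (t : R) : (t%:C)^* = t%:C :> R[i].
Proof. exact: conjc_real. Qed.

Lemma mul_conjc z : z * z^* = (normc z ^+ 2)%:C.
Proof. by rewrite rmorphXn /= real_normcE sqr_normc. Qed.

Lemma Re_le_normc z : Re z <= normc z.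
Proof.
apply: le_trans (ler_norm _) _; rewrite -lecR real_normcE; exact: normc_ge_Re.
Qed.

Lemma ReD z1 z2 : Re (z1 + z2) = Re z1 + Re z2.
Proof. by case: z1 z2 => ? ? []. Qed.

Lemma Re_realM (a : R) z : Re (a%:C * z) = a * Re z.
Proof. by case: z => x y /=; rewrite mul0r subr0. Qed.

(** Rotating by such a [u] turns a modulus into a real part, which reduces complex estimates to real
    ones below. *)
Lemma exists_phase z : exists2 u : R[i], normc u = 1 & u * z = (normc z)%:C.
Proof.
have [->|z0] := eqVneq z 0.
  by exists 1; rewrite ?ComplexField.Normc.normc1 ?mulr0 ?ComplexField.Normc.normc0.
have n0 : normc z != 0 by apply: contra_neq z0 => /ComplexField.Normc.eq0_normc.
exists ((normc z)^-1%:C * z^*).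
  rewrite ComplexField.Normc.normcM normc_conj normc_real ger0_norm ?mulVf //.
  by rewrite invr_ge0 normc_ge0.
by rewrite -mulrA (mulrC _ z) mul_conjc -rmorphM /= expr2 mulKf.
Qed.

End ComplexModulus.

(** For [b > 0], evaluate at the vertex [t = m / b]. For [b = 0] the expression is affine in [t], so
    [m] vanishes. *)
Lemma quadratic_discriminant (R : realFieldType) (a m b : R) :
  0 <= b -> (forall t, 0 <= a - 2 * t * m + t ^+ 2 * b) -> m ^+ 2 <= a * b.
Proof.
rewrite le_eqVlt => /predU1P[<- | b0] pos; last first.
  have := pos (m / b).
  have -> : a - 2 * (m / b) * m + (m / b) ^+ 2 * b = (a * b - m ^+ 2) / b.
    by field; rewrite gt_eqF.
  by rewrite pmulr_lge0 ?invr_gt0 // subr_ge0.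
have [->|m0] := eqVneq m 0; first by rewrite expr0n mulr0.
(* At this [t] the affine expression equals [-1]. *)
have := pos ((a + 1) / (2 * m)).
rewrite mulr0 addr0; have -> : 2 * ((a + 1) / (2 * m)) * m = a + 1 by field.
lra.
Qed.

Section SemiInnerProduct.
Variables (R : realType) (V : lmodType R[i]).

(** Definiteness is left out so that both [dot] and [dotA dot A] are instances; for the latter,
    [snorm] is convertible to [normA dot A]. *)
Record semi_inner (s : V -> V -> R[i]) : Prop := SemiInner {
  semi_linear : forall a x y z, s (a *: x + y) z = a * s x z + s y z;
  semi_conj : forall x y, s y x = (s x y)^*;
  semi_ge0 : forall x, 0 <= s x x }.

Definition snorm (s : V -> V -> R[i]) (x : V) : R := Num.sqrt (Re (s x x)).

Variables (s : V -> V -> R[i]) (sP : semi_inner s).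
Local Notation n := (snorm s).

Lemma semiDl x y z : s (x + y) z = s x z + s y z.
Proof. by rewrite -[x]scale1r semi_linear // mul1r scale1r. Qed.

Lemma semi0l z : s 0 z = 0.
Proof. by apply: (@addIr _ (s 0 z)); rewrite -semiDl !add0r. Qed.

Lemma semiZl a x z : s (a *: x) z = a * s x z.
Proof. by rewrite -[a *: x]addr0 semi_linear // semi0l addr0. Qed.

Lemma semiNl x z : s (- x) z = - s x z.
Proof. by rewrite -scaleN1r semiZl mulN1r. Qed.

Lemma semiBl x y z : s (x - y) z = s x z - s y z.
Proof. by rewrite semiDl semiNl. Qed.

Lemma semiDr x y z : s z (x + y) = s z x + s z y.
Proof. by rewrite (semi_conj sP) semiDl rmorphD /= -!(semi_conj sP). Qed.

Lemma semi0r z : s z 0 = 0.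
Proof. by rewrite (semi_conj sP) semi0l rmorph0. Qed.

Lemma semiZr a x z : s z (a *: x) = a^* * s z x.
Proof. by rewrite (semi_conj sP) semiZl rmorphM /= -(semi_conj sP). Qed.

Lemma semiNr x z : s z (- x) = - s z x.
Proof. by rewrite (semi_conj sP) semiNl rmorphN /= -(semi_conj sP). Qed.

Lemma semiBr x y z : s z (x - y) = s z x - s z y.
Proof. by rewrite semiDr semiNr. Qed.

Lemma snorm_ge0 x : 0 <= n x.
Proof. exact: sqrtr_ge0. Qed.

Lemma snormE x : s x x = (n x ^+ 2)%:C.
Proof.
have := semi_ge0 sP x; rewrite lecE /= => /andP[/eqP im re].
rewrite /snorm sqr_sqrtr //; case: (s x x) im re => a b /= -> _ //.
Qed.

Lemma Re_snorm x : Re (s x x) = n x ^+ 2.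
Proof. by rewrite snormE. Qed.

Lemma Re_semiC x y : Re (s y x) = Re (s x y).
Proof. by rewrite (semi_conj sP); case: (s x y). Qed.

Lemma sqr_snormD x y : n (x + y) ^+ 2 = n x ^+ 2 + n y ^+ 2 + 2 * Re (s x y).
Proof.
rewrite -!Re_snorm semiDl !semiDr !ReD (Re_semiC x y); ring.
Qed.

Lemma snormZ a x : n (a *: x) = normc a * n x.
Proof.
have sq : n (a *: x) ^+ 2 = (normc a * n x) ^+ 2.
  rewrite -Re_snorm semiZl semiZr mulrA mul_conjc Re_realM Re_snorm; ring.
apply/eqP; rewrite -(eqrXn2 (n := 2)) ?sq ?mulr_ge0 ?snorm_ge0 ?normc_ge0 //.
Qed.

Lemma snormN x : n (- x) = n x.
Proof. by rewrite /snorm semiNl semiNr opprK. Qed.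

Lemma snorm_distC x y : n (x - y) = n (y - x).
Proof. by rewrite -snormN opprB. Qed.

Lemma snorm0 : n 0 = 0.
Proof. by rewrite /snorm semi0l sqrtr0. Qed.

Lemma sqr_snormB x y : n (x - y) ^+ 2 = n x ^+ 2 + n y ^+ 2 - 2 * Re (s x y).
Proof.
rewrite sqr_snormD snormN semiNr; case: (s x y) => a b /=; ring.
Qed.

Lemma parallelogram x y :
  n (x + y) ^+ 2 + n (x - y) ^+ 2 = 2 * n x ^+ 2 + 2 * n y ^+ 2.
Proof. rewrite sqr_snormB sqr_snormD; ring. Qed.

(** After a phase makes [s x y] real, the discriminant of the nonnegative quadratic
    [t |-> n (x - t y) ^ 2] gives the bound. *)
Lemma Cauchy_Schwarz x y : normc (s x y) <= n x * n y.
Proof.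
have [u u1 us] := exists_phase (s x y).
have -> : normc (s x y) = Re (s (u *: x) y) by rewrite semiZl us.
have -> : n x = n (u *: x) by rewrite snormZ u1 mul1r.
move: (u *: x) => {us}x.
rewrite (le_trans (ler_norm _)) // -ler_sqr ?nnegrE ?mulr_ge0 ?snorm_ge0 //.
rewrite real_normK ?num_real // exprMn.
apply: quadratic_discriminant => [|t]; first exact: sqr_ge0.
have := sqr_ge0 (n (x - t%:C *: y)); rewrite sqr_snormB snormZ normc_real exprMn.
rewrite real_normK ?num_real // semiZr conj_realC Re_realM.
by move=> /le_trans; apply; rewrite le_eqVlt; apply/orP; left; apply/eqP; ring.
Qed.

Lemma snormD x y : n (x + y) <= n x + n y.
Proof.
rewrite -ler_sqr ?nnegrE ?addr_ge0 ?snorm_ge0 // sqr_snormD.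
have := le_trans (Re_le_normc _) (Cauchy_Schwarz x y); lra.
Qed.

(** The reflection [x' = 2 <x, e> e - x] has the seminorm of [x], and
    [2 <x, e> <e, y> = <x', y> + <x, y>]; Cauchy-Schwarz bounds [<x', y>]. *)
Lemma Buzano x y e : n e = 1 ->
  normc (s x e) * normc (s e y) <= (normc (s x y) + n x * n y) / 2.
Proof.
move=> e1; pose x' := (2 * s x e) *: e - x.
have nx' : n x' = n x.
  apply/eqP; rewrite -(eqrXn2 (n := 2)) ?snorm_ge0 //; apply/eqP.
  rewrite /x' sqr_snormB snormZ e1 semiZl (semi_conj sP x) -mulrA mul_conjc.
  have -> : (2 : R[i]) = 2%:C by rewrite rmorph_nat.
  rewrite ComplexField.Normc.normcM Re_realM normc_real ger0_norm //=; ring.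
have x'y : 2 * (s x e * s e y) = s x' y + s x y.
  by rewrite /x' semiBl semiZl; ring.
have n2 : normc (2 : R[i]) = 2.
  have -> : (2 : R[i]) = 2%:C by rewrite rmorph_nat.
  by rewrite normc_real ger0_norm.
have : 2 * (normc (s x e) * normc (s e y)) = normc (s x' y + s x y).
  by rewrite -x'y !ComplexField.Normc.normcM n2.
have := le_normcD (s x' y) (s x y); have := Cauchy_Schwarz x' y.
rewrite nx'; lra.
Qed.

End SemiInnerProduct.

(** * Hilbert space geometry *)

Section HilbertNorm.
Variables (R : realType) (H : completeNormedModType R[i]).
Variables (dot : {dot H for Num.conj}) (dotP : is_inner_product dot).
Local Notation n := (snorm dot).

Lemma dot_semi_inner : semi_inner dot.
Proof.
split=> [a x y z|x y|x]; last exact: dnorm_ge0.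
  by rewrite linearPl.
by rewrite hermC expr0 mul1r.
Qed.
Let sP := dot_semi_inner.

Lemma Hilbert_normE x : `|x| = (n x)%:C.
Proof.
apply/eqP; rewrite -(eqrXn2 (n := 2)) //; last by rewrite ler0c snorm_ge0.
by rewrite dotP (snormE sP) rmorphXn.
Qed.

Lemma snorm_dot_eq0 x : n x = 0 -> x = 0.
Proof. by move=> nx; apply/normr0_eq0; rewrite Hilbert_normE nx. Qed.

(** Balls of [H] have radii in [R[i]], but a positive radius is real. *)
Lemma closure_snormP (S : set H) x :
  closure S x <-> forall e : R, 0 < e -> exists2 y, S y & n (x - y) < e.
Proof.
split=> [Sx e e0|Sx B /nbhs_ballP[e /= e0 eB]].
  have [|y [Sy]] := Sx (ball x e%:C); first by apply: nbhsx_ballx; rewrite ltcR.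
  rewrite -ball_normE /= Hilbert_normE ltcR => ?; by exists y.
have eE : e = (Re e)%:C by rewrite RRe_real // gtr0_real.
have [|y Sy xy] := Sx (Re e); first by rewrite -ltcR -eE.
by exists y; split=> //; apply: eB; rewrite -ball_normE /= Hilbert_normE eE ltcR.
Qed.

Lemma snorm_complete (u : nat -> H) :
  (forall e : R, 0 < e -> exists N, forall i j, (N <= i)%N -> (N <= j)%N ->
    n (u i - u j) < e) ->
  exists l, forall e : R, 0 < e -> exists N, forall i, (N <= i)%N -> n (u i - l) < e.
Proof.
move=> uC.
have ucv : cvg (u @ \oo).
  apply: cauchy_cvg; apply: cauchy_exP => e e0.
  have eE : e = (Re e)%:C by rewrite RRe_real // gtr0_real.
  have [|N uN] := uC (Re e); first by rewrite -ltcR -eE.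
  exists (u N); exists N => // i /= Ni.
  by rewrite -ball_normE /= Hilbert_normE eE ltcR uN //=.
exists (lim (u @ \oo)) => e e0.
have /cvgrPdist_lt/(_ e%:C)[|N _ uN] := ucv; first by rewrite ltcR.
exists N => i Ni; rewrite snorm_distC // -ltcR -Hilbert_normE; exact: uN.
Qed.

End HilbertNorm.

(** * Elementary limiting arguments in the reals *)

Section RealEstimates.
Variable R : realType.
Implicit Types c K e q B : R.

Lemma le0_small_multiple c K : 0 <= K -> (forall e, 0 < e -> c <= e * K) -> c <= 0.
Proof.
move=> K0 cK; rewrite leNgt; apply/negP => c0.
have := cK (c / (2 * (K + 1))); have K1 : 0 < K + 1 by lra.
rewrite divr_gt0 ?mulr_gt0 // => /(_ isT).
rewrite mulrAC ler_pdivlMr ?mulr_gt0 // ler_pM2l //; lra.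
Qed.

(** Bernoulli's inequality and the archimedean property. *)
Lemma exists_expr_gt q B : 1 < q -> exists k, B < q ^+ k.
Proof.
move=> q1.
have bern k : 1 + k%:R * (q - 1) <= q ^+ k.
  elim: k => [|k IH]; first by rewrite mul0r addr0 expr0.
  rewrite exprS -natr1; apply: (@le_trans _ _ (q * (1 + k%:R * (q - 1)))).
    rewrite -subr_ge0 (_ : _ - _ = k%:R * (q - 1) ^+ 2); last by ring.
    by rewrite mulr_ge0 ?sqr_ge0.
  by rewrite ler_pM2l //; lra.
have [k] : exists k : nat, B / (q - 1) < k%:R.
  by exists (Num.bound `|B / (q - 1)|); rewrite (le_lt_trans (ler_norm _)) // archi_boundP.
rewrite ltr_pdivrMr ?subr_gt0 // => Bk; exists k; apply: lt_le_trans (bern k); lra.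
Qed.

Lemma exists_invS_lt e : 0 < e -> exists N, forall i, (N <= i)%N -> i.+1%:R^-1 < e.
Proof.
move=> e0; exists (Num.bound e^-1) => i Ni.
rewrite invf_plt ?posrE ?ltr0Sn // (lt_le_trans (archi_boundP _)) //.
  by rewrite invr_ge0 ltW.
by rewrite ler_nat ltnW.
Qed.

End RealEstimates.

(** * Orthogonal projection onto the closure of a subspace *)

Section Projection.
Variables (R : realType) (H : completeNormedModType R[i]).
Variables (dot : {dot H for Num.conj}) (dotP : is_inner_product dot).
Local Notation n := (snorm dot).
Let sP := dot_semi_inner dot.

Definition linear_subspace (S : set H) : Prop :=
  S 0 /\ forall (a : R[i]) x y, S x -> S y -> S (a *: x + y).

(** A minimizing sequence [u] for the distance to [x] is Cauchy by the parallelogram law; its limit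
    is [p]. Orthogonality holds approximately along [u] and passes to the limit. *)
Lemma orthogonal_projection (S : set H) x : linear_subspace S ->
  exists2 p, closure S p & forall m, S m -> dot (x - p) m = 0.
Proof.
case=> S0 Slin; pose E := [set n (x - m) ^+ 2 | m in S]; pose d := inf E.
have SD y z : S y -> S z -> S (y + z) by move=> Sy Sz; rewrite -[y]scale1r; apply: Slin.
have SZ a y : S y -> S (a *: y) by move=> Sy; rewrite -[_ *: _]addr0; apply: Slin.
have Elb : has_lbound E by exists 0 => _ [m _ <-]; apply: sqr_ge0.
have dle m : S m -> d <= n (x - m) ^+ 2 by move=> Sm; apply: ge_inf => //; exists m.
have /choice[u uP] : forall k : nat, exists m, S m /\ n (x - m) ^+ 2 < d + k.+1%:R^-1.
  move=> k; have [||_ [m Sm <-] lt_m] := @inf_adherent _ E k.+1%:R^-1.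
  - by rewrite invr_gt0.
  - by split=> //; exists (n (x - 0) ^+ 2), 0.
  by exists m.
have uC i j : n (u i - u j) ^+ 2 <= 2 * i.+1%:R^-1 + 2 * j.+1%:R^-1.
  have [Si lti] := uP i; have [Sj ltj] := uP j.
  (* The midpoint of [u i] and [u j] lies in [S], so its squared distance to [x] is at least [d];
     this bounds the sum term from below by [4 d]. *)
  have := parallelogram sP (x - u j) (x - u i).
  have -> : x - u j - (x - u i) = u i - u j by rewrite opprB addrC addrA subrK.
  have -> : x - u j + (x - u i) = (2%:C : R[i]) *: (x - (2^-1)%:C *: (u i + u j)).
    rewrite scalerBr scalerA.
    have -> : 2%:C * (2^-1)%:C = 1 :> R[i] by rewrite -rmorphM /= mulfV ?pnatr_eq0 ?rmorph1.
    rewrite scale1r.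
    rewrite (rmorph_nat (real_complex R)) scaler_nat mulr2n addrACA -opprD.
    by rewrite [u j + _]addrC.
  rewrite snormZ // normc_real ger0_norm // exprMn.
  have := dle _ (SZ (2^-1)%:C _ (SD _ _ Si Sj)).
  move: lti ltj; move: (i.+1%:R^-1) (j.+1%:R^-1) => a b; lra.
have [|p up] := snorm_complete dotP (u := u).
  move=> e e0; have [|N NP] := @exists_invS_lt _ (e ^+ 2 / 4).
    by rewrite divr_gt0 ?exprn_gt0.
  exists N => i j Ni Nj; rewrite -ltr_sqr ?nnegrE ?snorm_ge0 ?ltW //.
  have := uC i j; have := NP i Ni; have := NP j Nj.
  move: (i.+1%:R^-1) (j.+1%:R^-1) => a b; lra.
exists p.
  apply/(closure_snormP dotP) => e /up[N NP]; exists (u N); first by case: (uP N).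
  by rewrite (snorm_distC sP) NP.
move=> m Sm.
(* Moving [u k] inside [S] along [m] cannot bring the squared distance below [d]. The phase [a]
   makes the linear term in [t] real, and the discriminant bound applies. *)
have near_orth k : normc (dot (x - u k) m) ^+ 2 <= k.+1%:R^-1 * n m ^+ 2.
  have [Sk ltk] := uP k; have [a a1 aE] := exists_phase (dot (x - u k) m).
  have am t : n (x - u k - t%:C *: (a^* *: m)) ^+ 2 =
      n (x - u k) ^+ 2 - 2 * t * normc (dot (x - u k) m) + t ^+ 2 * n m ^+ 2.
    rewrite (sqr_snormB sP) !(snormZ sP) !(semiZr sP) conj_realC conjCK aE Re_realM.
    rewrite normc_conj a1 mul1r exprMn normc_real real_normK ?num_real //=; ring.
  apply: le_trans (_ : (n (x - u k) ^+ 2 - d) * n m ^+ 2 <= _); last first.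
    by apply: ler_wpM2r; rewrite ?sqr_ge0 // lerBlDl ltW.
  apply: quadratic_discriminant => [|t]; first exact: sqr_ge0.
  have := dle _ (SD _ _ Sk (SZ t%:C _ (SZ a^* _ Sm))).
  rewrite opprD addrA am; lra.
apply: ComplexField.Normc.eq0_normc; apply/eqP; rewrite eq_le normc_ge0 andbT.
(* One [e * n m] comes from [near_orth], the other from replacing [p] by [u k]. *)
apply: (@le0_small_multiple _ _ (2 * n m)) => [|e e0].
  by rewrite mulr_ge0 ?snorm_ge0.
have [N NP] := up _ e0.
have [|N' N'P] := @exists_invS_lt _ (e ^+ 2); first by rewrite exprn_gt0.
pose k := maxn N N'; have {}NP := NP k (leq_maxl _ _); have {}N'P := N'P k (leq_maxr _ _).
have -> : x - p = (x - u k) + (u k - p) by rewrite addrA subrK.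
rewrite (semiDl sP); apply: le_trans (le_normcD _ _) _.
have := Cauchy_Schwarz sP (u k - p) m.
have : normc (dot (x - u k) m) <= e * n m.
  rewrite -ler_sqr ?nnegrE ?normc_ge0 ?mulr_ge0 ?snorm_ge0 ?(ltW e0) // exprMn.
  by apply: le_trans (near_orth k) _; apply: ler_wpM2r; rewrite ?sqr_ge0 // ltW.
have : n (u k - p) * n m <= e * n m by rewrite ler_wpM2r ?snorm_ge0 // ltW.
lra.
Qed.

End Projection.

(** * Riesz representation and existence of adjoints *)

Section Riesz.
Variables (R : realType) (H : completeNormedModType R[i]).
Variables (dot : {dot H for Num.conj}) (dotP : is_inner_product dot).
Local Notation n := (snorm dot).
Let sP := dot_semi_inner dot.

(** If [f x0 <> 0], subtracting from [x0] its projection on the kernel leaves [w] orthogonal to the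
    kernel. Each [x - (f x / f w) w] is in the kernel, so [v] is a multiple of [w]. *)
Lemma Riesz_representation (f : H -> R[i]) (c : R) :
  (forall a x y, f (a *: x + y) = a * f x + f y) ->
  (forall x, normc (f x) <= c * n x) -> exists v, forall x, f x = dot x v.
Proof.
move=> flin fc.
have f0 : f 0 = 0.
  have := flin 1 0 0; rewrite scale1r mul1r add0r => /eqP.
  by rewrite eq_sym -subr_eq0 addrK => /eqP.
have fB x y : f (x - y) = f x - f y.
  by rewrite addrC -scaleN1r flin mulN1r addrC.
pose S := [set x | f x = 0].
have Slin : linear_subspace S.
  by split=> // a x y fx fy; rewrite /S /= flin fx fy mulr0 addr0.
have [[x0 fx0]|f_eq0] := pselect (exists x, f x <> 0); last first.
  exists 0 => x; rewrite (semi0r sP); apply: contrapT => fx; apply: f_eq0.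
  by exists x.
have [p Sp orth] := orthogonal_projection dotP x0 Slin.
(* The projection is only known to lie in the closure of the kernel; boundedness of [f] puts it in
   the kernel. *)
have fp : f p = 0.
  apply: ComplexField.Normc.eq0_normc; apply/eqP; rewrite eq_le normc_ge0 andbT.
  apply: (@le0_small_multiple _ _ `|c|) => // e e0.
  have [y fy py] := (closure_snormP dotP S p).1 Sp e e0.
  rewrite -[f p]subr0 -fy -fB (le_trans (fc _)) // mulrC.
  apply: le_trans (ler_wpM2l (snorm_ge0 _ _) (ler_norm c)) _.
  by rewrite ler_wpM2r // ltW.
pose w := x0 - p; have fw : f w != 0 by rewrite fB fp subr0; apply/eqP.
have {}orth m : S m -> dot w m = 0 by exact: orth.
have ww : dot w w != 0.
  by rewrite dnorm_eq0; apply: contra_neq fw => ->.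
exists ((f w / dot w w)^* *: w) => x; rewrite (semiZr sP) conjCK.
have : S (- (f x / f w) *: w + x).
  by rewrite /S /= flin mulNr divfK // addNr.
move=> /orth/(congr1 Num.conj); rewrite rmorph0 -(semi_conj sP) (semi_linear sP).
move=> /eqP; rewrite addrC mulNr subr_eq0 => /eqP ->.
by field; apply/andP.
Qed.

(** The constant of [bounded_operator] lives in [R[i]]; its modulus serves as a real nonnegative
    one. *)
Lemma bounded_operatorP (T : H -> H) :
  bounded_operator T <->
  linear T /\ exists2 c : R, 0 <= c & forall x, n (T x) <= c * n x.
Proof.
split=> -[Tlin].
  move=> [c Tc]; split=> //; exists (normc c); first exact: normc_ge0.
  move=> x; rewrite -lecR rmorphM /= -!(Hilbert_normE dotP) real_normcE.
  by rewrite -[`|x|]normr_id -normrM ger0_norm // (le_trans _ (Tc x)).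
move=> [c c0 Tc]; split=> //; exists c%:C => x.
by rewrite !(Hilbert_normE dotP) -rmorphM lecR.
Qed.

Lemma linear_fun0 (T : H -> H) : linear T -> T 0 = 0.
Proof.
by move=> /(_ 1 0 0); rewrite !scale1r add0r => /eqP; rewrite eq_sym -subr_eq0 addrK => /eqP.
Qed.

Lemma linear_funB (T : H -> H) : linear T -> {morph T : x y / x - y}.
Proof.
by move=> Tlin x y; rewrite addrC -scaleN1r Tlin scaleN1r addrC.
Qed.

Lemma dot_inj_r x y : (forall z, dot z x = dot z y) -> x = y.
Proof.
move=> xy; apply/eqP; rewrite -subr_eq0 -(dnorm_eq0 dot) (semiBr sP).
by rewrite xy subrr.
Qed.

(** [S y] is the Riesz vector of [x |-> <T x, y>], and [|S y|^2 = <T (S y), y>] bounds it by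
    [c |y|]. Existence of [S] rules out the default value of [xget]. *)
Lemma bounded_adjoint (T : H -> H) : bounded_operator T ->
  bounded_operator (adjoint dot T) /\ forall x y, dot (T x) y = dot x (adjoint dot T y).
Proof.
move=> TB; have [Tlin [c c0 Tc]] := (bounded_operatorP T).1 TB.
have /choice[S TS] : forall y, exists v, forall x, dot (T x) y = dot x v.
  move=> y; apply: (@Riesz_representation (fun x => dot (T x) y) (c * n y)).
    by move=> a x1 x2; rewrite Tlin (semi_linear sP).
  move=> x; rewrite (le_trans (Cauchy_Schwarz sP _ _)) // mulrAC.
  by rewrite ler_wpM2r ?snorm_ge0.
suff SP : [set S : H -> H | bounded_operator S /\
    forall x y, dot (T x) y = dot x (S y)] S.
  by exact: (@xgetPex _ (fun=> 0) _ (ex_intro _ S SP)).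
split=> [|x y //]; apply/bounded_operatorP; split.
  move=> a x y; apply: dot_inj_r => z.
  by rewrite (semiDr sP) (semiZr sP) -!TS (semiDr sP) (semiZr sP).
exists c => // y.
have [->|Sy] := eqVneq (n (S y)) 0; first by rewrite mulr_ge0 ?snorm_ge0.
have Sy0 : 0 < n (S y) by rewrite lt_def Sy snorm_ge0.
rewrite -(ler_pM2l Sy0) -expr2 -(Re_snorm sP) -TS (le_trans (Re_le_normc _)) //.
rewrite (le_trans (Cauchy_Schwarz sP _ _)) // mulrCA mulrA.
by rewrite ler_wpM2r ?snorm_ge0.
Qed.

End Riesz.

(** * Uniform boundedness *)

Section UniformBoundedness.
Variables (R : realType) (H : completeNormedModType R[i]).
Variables (dot : {dot H for Num.conj}) (dotP : is_inner_product dot).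
Local Notation n := (snorm dot).
Let sP := dot_semi_inner dot.

(** With [u] the multiple of [v] of norm [r], the values at [x + u] and [x - u] differ by [2 r |v|],
    so one of them has modulus at least [r |v|]. *)
Lemma exists_large_value (v x : H) (r : R) : 0 <= r -> n v != 0 ->
  exists y, n (y - x) <= r /\ r * n v <= normc (dot y v).
Proof.
move=> r0 v0; pose u : H := (r / n v)%:C *: v.
have nu : n u = r.
  rewrite (snormZ sP) normc_real ger0_norm; first by rewrite divfK.
  by rewrite divr_ge0 ?snorm_ge0.
have uv : dot u v = (r * n v)%:C.
  by rewrite (semiZl sP) (snormE sP) -rmorphM /=; congr (_%:C); field.
have : normc (dot (x + u) v) + normc (dot (x - u) v) >= 2 * (r * n v).
  have := le_normcD (dot (x + u) v) (- dot (x - u) v).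
  rewrite normcN (semiDl sP) (semiBl sP) uv.
  have -> : dot x v + (r * n v)%:C - (dot x v - (r * n v)%:C) = (2 * (r * n v))%:C.
    by rewrite [RHS]rmorphM /= (rmorph_nat (real_complex R)); ring.
  by rewrite normc_real ger0_norm // !mulr_ge0 ?snorm_ge0.
have [? _|? ?] := leP (r * n v) (normc (dot (x + u) v)).
  by exists (x + u); rewrite addrAC subrr add0r nu.
exists (x - u); rewrite addrAC subrr add0r (snormN sP) nu; split=> //; lra.
Qed.

(* Sokal's gliding hump, which replaces an appeal to the Baire category theorem. *)
Lemma uniform_boundedness (F : set H) :
  (forall x, exists M : R, forall v, F v -> normc (dot x v) <= M) ->
  exists2 M : R, 0 <= M & forall v, F v -> n v <= M.
Proof.
move=> weak; apply: contrapT => unbounded.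
have /choice[v vP] : forall k : nat, exists v, F v /\ 4 ^+ k < n v.
  move=> k; apply: contrapT => nv; apply: unbounded; exists (4 ^+ k) => [|w Fw].
    by rewrite exprn_ge0.
  by rewrite leNgt; apply/negP => ?; apply: nv; exists w.
(* Steps of size [3^-k] are summable, while [r k * n (v k)] exceeds [(4 / 3)^k]. *)
pose r k : R := 3^-1 ^+ k.
have r0 k : 0 < r k by rewrite exprn_gt0 ?invr_gt0.
have v0 k : 0 < n (v k) by apply: lt_trans (vP k).2; rewrite exprn_gt0.
have /choice[f fP] : forall kx : nat * H, exists y,
    n (y - kx.2) <= r kx.1 /\ r kx.1 * n (v kx.1) <= normc (dot y (v kx.1)).
  by case=> k x; apply: exists_large_value; rewrite ?ltW ?gt_eqF.
pose fix xs k := if k is k'.+1 then f (k', xs k') else 0.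
(* The right side is the geometric sum of [r k], ..., [r (k + j - 1)]. *)
have xs_step k j : n (xs (k + j)%N - xs k) <= 3 / 2 * (r k - r (k + j)%N).
  elim: j => [|j IH]; first by rewrite addn0 !subrr mulr0 (snorm0 sP).
  have /= [step _] := fP ((k + j)%N, xs (k + j)%N).
  have -> : xs (k + j.+1)%N - xs k =
      (xs (k + j).+1 - xs (k + j)%N) + (xs (k + j)%N - xs k).
    by rewrite addrA subrK addnS.
  rewrite (le_trans (snormD sP _ _)) //= addnS /r (exprS _ (k + j)) -!/(r _).
  by move: step IH; rewrite -/(r _); lra.
have [e e0|l xl] := snorm_complete dotP (u := xs).
  have [|N rN] := @exists_expr_gt _ 3 (3 / e); first lra.
  have {}rN : 3 * r N < e.
    by rewrite /r exprVn ltr_pdivrMr ?exprn_gt0 // mulrC -ltr_pdivrMr.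
  exists N => i j Ni Nj; rewrite -(subrKA (xs N)) (le_lt_trans (snormD sP _ _)) //.
  have := xs_step N (i - N)%N; have := xs_step N (j - N)%N.
  rewrite !subnKC // [n (xs j - _)](snorm_distC sP); have := r0 i; have := r0 j; lra.
have xl_close k : n (xs k - l) <= 3 / 2 * r k.
  rewrite -subr_le0; apply: (@le0_small_multiple _ _ 1) => // e /xl[N Nl].
  have := Nl (k + N)%N (leq_addl _ _); have := xs_step k N.
  have := snormD sP (xs k - xs (k + N)%N) (xs (k + N)%N - l).
  rewrite addrA subrK [n (xs k - xs (k + N)%N)](snorm_distC sP).
  have := r0 (k + N)%N; lra.
have [M lM] := weak l.
have [|k Mk] := @exists_expr_gt R (4 / 3) (2 * M); first lra.
have [Fv vk] := vP k.
have := lM _ Fv; apply/negP; rewrite -ltNge.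
have /= [_ large] := fP (k, xs k).
(* The tail after step [k.+1] is at most [3 / 2 * r k.+1 = r k / 2], so it destroys at most half of
   the value [r k * n (v k)] gained at that step; hence the threshold [2 * M]. *)
have lv : normc (dot (xs k.+1 - l) (v k)) <= r k / 2 * n (v k).
  rewrite (le_trans (Cauchy_Schwarz sP _ _)) // ler_wpM2r ?snorm_ge0 //.
  by apply: le_trans (xl_close _) _; rewrite /r exprS; lra.
have := le_normcD (dot l (v k)) (dot (xs k.+1 - l) (v k)).
rewrite -(semiDl sP) addrC subrK /=.
have : (4 / 3) ^+ k < r k * n (v k).
  by rewrite expr_div_n mulrC /r exprVn ltr_pM2l ?invr_gt0 ?exprn_gt0.
move: large lv Mk => /=; lra.
Qed.

End UniformBoundedness.

(** * The A-adjoint *)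

Section Sharp.
Variables (R : realType) (H : completeNormedModType R[i]).
Variables (dot : {dot H for Num.conj}) (dotP : is_inner_product dot).
Local Notation n := (snorm dot).
Let sP := dot_semi_inner dot.

Lemma closure_linear_subspace (S : set H) :
  linear_subspace S -> linear_subspace (closure S).
Proof.
move=> [S0 Slin]; split; first exact: subset_closure.
move=> a x y /(closure_snormP dotP) Sx /(closure_snormP dotP) Sy.
apply/(closure_snormP dotP) => e e0; have a0 := normc_ge0 a.
(* The [+ 1] keeps the denominator positive when [a = 0]; the scaled error stays within [e / 2]. *)
have d0 : 0 < e / (2 * (normc a + 1)) by rewrite divr_gt0 //; lra.
have [x' Sx' xx'] := Sx _ d0; have [|y' Sy' yy'] := Sy (e / 2); first lra.
exists (a *: x' + y'); first exact: Slin.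
rewrite opprD addrACA -scalerBr (le_lt_trans (snormD sP _ _)) // (snormZ sP).
move: xx'; rewrite ltr_pdivlMr; last lra.
have := snorm_ge0 dot (x - x'); nra.
Qed.

(** [|x|^2 = <x, x - y>] for every [y] in [S], and [y] can approach [x]. *)
Lemma closure_orthogonal0 (S : set H) x :
  closure S x -> (forall m, S m -> dot x m = 0) -> x = 0.
Proof.
move=> /(closure_snormP dotP) Sx orth; apply: (snorm_dot_eq0 dotP).
apply/eqP; rewrite -sqrf_eq0 eq_le sqr_ge0 andbT.
apply: (@le0_small_multiple _ _ (n x)) => [|e /Sx[y Sy xy]]; first exact: snorm_ge0.
rewrite -(Re_snorm sP) -[dot x x]subr0 -(orth y Sy) -(semiBr sP).
rewrite (le_trans (Re_le_normc _)) // (le_trans (Cauchy_Schwarz sP _ _)) // mulrC.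
by rewrite ler_wpM2r ?snorm_ge0 ?ltW.
Qed.

Lemma range_linear_subspace (T : H -> H) : linear T -> linear_subspace (range T).
Proof.
move=> Tlin; split; first by exists 0; rewrite ?linear_fun0.
by move=> a _ _ [x _ <-] [y _ <-]; exists (a *: x + y); rewrite ?Tlin.
Qed.

Variables (A : H -> H) (A_positive : positive_operator dot A).

Lemma positive_symmetric x y : dot (A x) y = dot x (A y).
Proof. by case: A_positive => AB AA _; rewrite (bounded_adjoint dotP AB).2 AA. Qed.

Lemma positive_linear : linear A.
Proof. by case: A_positive => -[]. Qed.

Lemma dotA_semi_inner : semi_inner (dotA dot A).
Proof.
split=> [a x y z|x y|x]; rewrite /dotA.
- by rewrite positive_linear (semi_linear sP).
- by rewrite positive_symmetric (semi_conj sP).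
- by case: A_positive.
Qed.

(** The vector [x - p] is orthogonal to the range of the symmetric [A], hence in its kernel. This
    moves any vector into the closure of the range without changing its image under [A]. *)
Lemma range_projection x :
  exists2 p, closure (range A) p & A p = A x.
Proof.
have [p Sp orth] := orthogonal_projection dotP x (range_linear_subspace positive_linear).
exists p => //; apply/esym/eqP; rewrite -subr_eq0 -(linear_funB positive_linear).
apply/eqP/(dot_inj_r (dot := dot)) => z; rewrite -positive_symmetric (semi_conj sP) orth.
  by rewrite rmorph0 (semi0r sP).
by exists z.
Qed.

(** The difference lies in the closure of the range and, being in the kernel, is orthogonal to the
    range. This makes the A-adjoint linear. *)
Lemma closure_range_inj x y : closure (range A) x -> closure (range A) y ->
  A x = A y -> x = y.
Proof.
have [_ Clin] := closure_linear_subspace (range_linear_subspace positive_linear).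
move=> Cx Cy Axy; apply/eqP; rewrite -subr_eq0; apply/eqP.
apply: (@closure_orthogonal0 (range A)) => [|_ [z _ <-]].
  by rewrite addrC -scaleN1r; apply: Clin.
by rewrite -positive_symmetric (linear_funB positive_linear) Axy subrr (semi0l sP).
Qed.

Variables (T : H -> H) (T_BA : BA dot A T).

Lemma sharpA_spec :
  bounded_operator (sharpA dot A T) /\ A \o sharpA dot A T = adjoint dot T \o A.
Proof.
have [TB Trange] := T_BA; have [Sbd TS] := bounded_adjoint dotP TB.
have [Slin _] := Sbd; have [Tlin _] := TB; have Alin := positive_linear.
have Clin := (closure_linear_subspace (range_linear_subspace Alin)).2.
have /choice[X XP] : forall x, exists y, closure (range A) y /\ A y = adjoint dot T (A x).
  move=> x; have [|z _ Az] := Trange (adjoint dot T (A x)); first by exists x.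
  by have [p Cp Ap] := range_projection z; exists p; rewrite Ap.
have XC x := (XP x).1; have AX x := (XP x).2.
have XA x z : dot (X x) (A z) = dot x (A (T z)).
  by rewrite -positive_symmetric AX (semi_conj sP) -TS -(semi_conj sP) positive_symmetric.
(* By [XA], pairing [x] with [A (T z)] is pairing [X x] with [A z], so for each [x] the values are
   bounded by [n (X x)]. *)
have [M M0 MP] : exists2 M : R, 0 <= M &
    forall v, [set A (T z) | z in [set z | n (A z) <= 1]] v -> n v <= M.
  apply: (uniform_boundedness dotP) => x; exists (n (X x)) => _ [z Az <-].
  rewrite -XA (le_trans (Cauchy_Schwarz sP _ _)) //.
  by rewrite -[leRHS]mulr1 ler_wpM2l ?snorm_ge0.
(* Rescaling [z] to [n (A z) = 1] gives the homogeneous form; when [A z = 0] the left side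
   vanishes. *)
have XAM x z : normc (dot (X x) (A z)) <= M * n x * n (A z).
  have [Az0|Az0] := eqVneq (n (A z)) 0.
    rewrite (snorm_dot_eq0 dotP Az0) (semi0r sP) (snorm0 sP) mulr0.
    by rewrite ComplexField.Normc.normc0.
  have nAz : 0 < n (A z) by rewrite lt_def Az0 snorm_ge0.
  pose a : R[i] := (n (A z))^-1%:C.
  have na : normc a = (n (A z))^-1 by rewrite normc_real ger0_norm // invr_ge0 ltW.
  have AZ y : A (a *: y) = a *: A y.
    by have := Alin a y 0; rewrite (linear_fun0 Alin) !addr0.
  have TZ y : T (a *: y) = a *: T y.
    by have := Tlin a y 0; rewrite (linear_fun0 Tlin) !addr0.
  have : n (A (T (a *: z))) <= M.
    by apply: MP; exists (a *: z) => //=; rewrite AZ (snormZ sP) na mulVf.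
  rewrite TZ AZ (snormZ sP) na ler_pdivrMl // => ATz.
  rewrite XA (le_trans (Cauchy_Schwarz sP _ _)) //.
  by have := snorm_ge0 dot x; nra.
suff XS : [set X : H -> H | [/\ bounded_operator X,
    A \o X = adjoint dot T \o A & range X `<=` closure (range A)]] X.
  by have [] := @xgetPex _ (fun=> 0) _ (ex_intro _ X XS).
split; last by move=> _ [x _ <-].
  apply/(bounded_operatorP dotP); split.
    move=> a x y; apply: closure_range_inj => //; first exact: Clin.
    by rewrite AX !Alin Slin !AX.
  exists M => // x; have [->|Xx] := eqVneq (n (X x)) 0.
    by rewrite mulr_ge0 ?snorm_ge0.
  have nXx : 0 < n (X x) by rewrite lt_def Xx snorm_ge0.
  rewrite -(ler_pM2r nXx) -expr2 -subr_le0.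
  (* With [A z] within [e] of [X x], one gets [|X x|^2 <= |X x| e + M |x| (|X x| + e)], which
     explains the constant. *)
  apply: (@le0_small_multiple _ _ (n (X x) + M * n x)) => [|e e0].
    by rewrite addr_ge0 ?mulr_ge0 ?snorm_ge0.
  have [_ [z _ <-] Xz] := (closure_snormP dotP _ _).1 (XC x) e e0.
  have : n (X x) ^+ 2 <= n (X x) * n (X x - A z) + M * n x * n (A z).
    rewrite -(Re_snorm sP) -{2}(subrK (A z) (X x)) (semiDr sP) ReD lerD //.
      exact: le_trans (Re_le_normc _) (Cauchy_Schwarz sP _ _).
    exact: le_trans (Re_le_normc _) (XAM _ _).
  have nAz : n (A z) <= n (X x) + e.
    rewrite -{1}(subKr (X x) (A z)) (le_trans (snormD sP _ _)) // (snormN sP).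
    by rewrite lerD2l ltW.
  have Mx : 0 <= M * n x by rewrite mulr_ge0 ?snorm_ge0.
  have := ler_wpM2l Mx nAz; have := ler_wpM2l (ltW nXx) (ltW Xz).
  move: (M * n x) => a; lra.
by apply/funext => x /=.
Qed.

Lemma dotA_sharpA x y : dotA dot A (sharpA dot A T x) y = dotA dot A x (T y).
Proof.
have [TB _] := T_BA; have TS := (bounded_adjoint dotP TB).2.
have /(congr1 (@^~ x)) /= AX := sharpA_spec.2.
by rewrite /dotA AX (semi_conj sP) -TS -(semi_conj sP).
Qed.

End Sharp.

(** * Operators with an adjoint for a semi-inner product *)

Section SemiAdjoint.
Variables (R : realType) (V : lmodType R[i]).
Variables (s : V -> V -> R[i]) (sP : semi_inner s).
Local Notation n := (snorm s).

(** For [s := dotA dot A] this is [A]-boundedness. *)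
Definition semi_bounded (B : V -> V) : Prop :=
  exists2 c : R, 0 <= c & forall x, n (B x) <= c * n x.

Lemma semi_bounded_comp B C :
  semi_bounded B -> semi_bounded C -> semi_bounded (B \o C).
Proof.
move=> [b b0 Bb] [c c0 Cc]; exists (b * c) => [|x]; first exact: mulr_ge0.
by rewrite (le_trans (Bb _)) // -mulrA ler_wpM2l.
Qed.

Lemma semi_boundedD B C :
  semi_bounded B -> semi_bounded C -> semi_bounded (B + C).
Proof.
move=> [b b0 Bb] [c c0 Cc]; exists (b + c) => [|x]; first exact: addr_ge0.
by rewrite (le_trans (snormD sP _ _)) // mulrDl lerD.
Qed.

Lemma semi_boundedZ a B : semi_bounded B -> semi_bounded (a *: B).
Proof.
move=> [b b0 Bb]; exists (normc a * b) => [|x]; first by rewrite mulr_ge0 ?normc_ge0.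
by rewrite (snormZ sP) -mulrA ler_wpM2l ?normc_ge0.
Qed.

(* The norms of the iterates of a symmetric operator form a log-convex sequence. *)
Lemma symmetric_growth_bound (S : V -> V) (x : V) (K M : R) :
  (forall y z, s (S y) z = s y (S z)) -> 0 < M ->
  (forall k, n (iter k S x) <= K * M ^+ k) -> n (S x) <= M * n x.
Proof.
move=> Ssym M0 growth; pose a k := n (iter k S x).
have a_ge0 k : 0 <= a k by exact: snorm_ge0.
have logconvex k : a k.+1 ^+ 2 <= a k * a k.+2.
  rewrite -(Re_snorm sP) [s _ _]Ssym (le_trans (Re_le_normc _)) //.
  exact: Cauchy_Schwarz.
rewrite -[n (S x)]/(a 1%N) -[n x]/(a 0%N) leNgt; apply/negP => Ma0.
have a0 : 0 < a 0%N.
  rewrite lt_def a_ge0 andbT; apply/eqP => a0.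
  by have := logconvex 0%N; rewrite a0 mul0r => ?; move: Ma0; rewrite a0; nra.
(* Log-convexity keeps all later ratios at least [r], so [a k >= a 0 * r ^ k]; as [r > M], this
   outgrows [K * M ^ k]. *)
pose r := a 1%N / a 0%N.
have Mr : M < r by rewrite ltr_pdivlMr.
have r0 : 0 < r by apply: lt_trans Mr.
have grow k : 0 < a k /\ r * a k <= a k.+1.
  elim: k => [|k [ak rak]]; first by rewrite divfK ?gt_eqF.
  have ak1 : 0 < a k.+1 by apply: lt_le_trans rak; rewrite mulr_gt0.
  split=> //; rewrite -(ler_pM2l ak) (le_trans _ (logconvex k)) //.
  by rewrite mulrA expr2 [a k * r]mulrC ler_wpM2r // ltW.
have exp_grow k : a 0%N * r ^+ k <= a k.
  elim: k => [|k IH]; first by rewrite mulr1.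
  apply: le_trans (grow k).2; rewrite exprS mulrCA ler_wpM2l // ltW //.
have [|k] := @exists_expr_gt R (r / M) (K / a 0%N); first by rewrite ltr_pdivlMr ?mul1r.
rewrite ltr_pdivrMr // expr_div_n mulrAC ltr_pdivlMr ?exprn_gt0 //; apply/negP.
rewrite -leNgt; apply: le_trans (growth k); rewrite mulrC; exact: exp_grow.
Qed.

Variables (X T : V -> V) (XT : forall x y, s (X x) y = s x (T y)).

Lemma semi_adjointC x y : s (T x) y = s x (X y).
Proof. by rewrite (semi_conj sP) -XT -(semi_conj sP). Qed.

(** From [|X x|^2 = <x, T (X x)> <= c |x| |X x|]. *)
Lemma semi_adjoint_bounded : semi_bounded T -> semi_bounded X.
Proof.
move=> [c c0 Tc]; exists c => // x.
have [->|Xx] := eqVneq (n (X x)) 0; first by rewrite mulr_ge0 ?snorm_ge0.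
have Xx0 : 0 < n (X x) by rewrite lt_def Xx snorm_ge0.
rewrite -(ler_pM2l Xx0) -expr2 -(Re_snorm sP) XT (le_trans (Re_le_normc _)) //.
rewrite (le_trans (Cauchy_Schwarz sP _ _)) // mulrC mulrCA mulrA.
by rewrite ler_wpM2r ?snorm_ge0.
Qed.

Lemma Re_semi_adjointl x : Re (s (X (T x)) x) = n (T x) ^+ 2.
Proof. by rewrite XT Re_snorm. Qed.

Lemma Re_semi_adjointr x : Re (s (T (X x)) x) = n (X x) ^+ 2.
Proof. by rewrite semi_adjointC Re_snorm. Qed.

(** In Buzano's inequality for [T x], [X x] and [x], both factors on the left are [<T x, x>], and
    [<T x, X x> = <T (T x), x>]; the product [|T x| |X x|] is bounded by half the sum of squares. *)
Lemma sqr_form_le x : n x = 1 ->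
  normc (s (T x) x) ^+ 2
    <= normc (s (T (T x)) x) / 2 + (n (T x) ^+ 2 + n (X x) ^+ 2) / 4.
Proof.
move=> x1; have := Buzano sP (T x) (X x) x1.
rewrite -!semi_adjointC -expr2.
have := sqr_ge0 (n (T x) - n (X x)); nra.
Qed.

End SemiAdjoint.

(** * A-seminorms *)

Section SupremumFacts.
Variable R : realType.
Implicit Types (E : set R) (b : R).

Lemma sup_nneg E : (forall e, E e -> 0 <= e) -> 0 <= sup E.
Proof.
move=> E0; have [[[e Ee] Eub]|/sup_out-> //] := pselect (has_sup E).
exact: le_trans (E0 e Ee) (ub_le_sup Eub Ee).
Qed.

(** The sign of [b] handles the empty set, whose [sup] is 0; this occurs for [A = 0]. *)
Lemma sup_le_nneg E b : 0 <= b -> (forall e, E e -> e <= b) -> sup E <= b.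
Proof.
move=> b0 Eb; have [->|/set0P E0] := eqVneq E set0; first by rewrite sup0.
exact: ge_sup.
Qed.

(** Exchanging [x] and [y] in the hypothesis gives continuity, and the extreme value theorem
    applies. *)
Lemma lipschitz_min (f : R -> R) (K a b : R) : a <= b ->
  (forall x y, f x <= f y + K * `|x - y|) ->
  exists2 c, a <= c <= b & forall t, a <= t <= b -> f c <= f t.
Proof.
move=> ab fK.
have fcont : continuous f.
  move=> x; apply/cvgrPdist_lt => e e0.
  have K0 : 0 < `|K| + 1 by rewrite ltr_wpDl.
  near=> y; rewrite ltr_distlC.
  have : `|x - y| < e / (`|K| + 1).
    by near: y; apply: cvgr_dist_lt; rewrite ?divr_gt0 //; exact: cvg_id.
  rewrite ltr_pdivlMr // => xy.
  have Kxy : K * `|x - y| < e.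
    apply: le_lt_trans xy; rewrite mulrC ler_wpM2l //.
    by rewrite (le_trans (ler_norm K)) // lerDl.
  have := fK x y; have := fK y x; rewrite [`|y - x|]distrC.
  by move: (K * _) Kxy => k ? ? ?; apply/andP; split; lra.
have [c cab cmin] := EVT_min ab (continuous_subspaceT fcont).
by exists c => [|t tab]; [rewrite in_itv in cab | apply: cmin; rewrite in_itv].
Unshelve. all: by end_near. Qed.

End SupremumFacts.

(** * Bounds between operators and their A-seminorm or A-numerical radius *)

Section SemiHilbertNorms.
Variables (R : realType) (H : completeNormedModType R[i]).
Variables (dot : {dot H for Num.conj}) (dotP : is_inner_product dot).
Variables (A : H -> H) (A_positive : positive_operator dot A).
Local Notation n := (snorm dot).
Local Notation nA := (normA dot A).
Let sP := dot_semi_inner dot.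
Let aP : semi_inner (dotA dot A) := dotA_semi_inner dotP A_positive.

(** [<A x, x> <= c |x|^2 <= (c + 1)^2 |x|^2], which avoids the root of [c]. *)
Lemma normA_le_norm : exists2 c : R, 0 <= c & forall x, nA x <= c * n x.
Proof.
have [/(bounded_operatorP dotP)[_ [c c0 Ac]] _ _] := A_positive.
exists (c + 1) => [|x]; first by rewrite addr_ge0.
have nx := snorm_ge0 dot x.
rewrite -ler_sqr ?nnegrE ?mulr_ge0 ?addr_ge0 ?snorm_ge0 //.
rewrite -(Re_snorm aP) (le_trans (Re_le_normc _)) //.
apply: le_trans (Cauchy_Schwarz sP _ _) _.
apply: le_trans (ler_wpM2r nx (Ac x)) _; rewrite -mulrA -expr2 exprMn.
by rewrite ler_wpM2r ?sqr_ge0 //; nra.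
Qed.

Lemma ker_normA0 x : A x = 0 -> nA x = 0.
Proof. by move=> Ax; rewrite /normA /dotA Ax (semi0l sP) sqrtr0. Qed.

Lemma opnormA_ge0 B : 0 <= opnormA dot A B.
Proof.
by apply: sup_nneg => _ [x _ <-]; rewrite divr_ge0 ?sqrtr_ge0.
Qed.

Lemma opnormA_le B (K : R) : 0 <= K -> (forall x, nA (B x) <= K * nA x) ->
  opnormA dot A B <= K.
Proof.
move=> K0 BK; apply: sup_le_nneg => // _ [x _ <-].
(* Division by zero gives 0, so such a quotient is harmless. *)
have [x0|x0] := eqVneq (nA x) 0; first by rewrite x0 invr0 mulr0.
by rewrite ler_pdivrMr // lt_def x0 sqrtr_ge0.
Qed.

(** The supremum sees only the closure of the range, so [x] is replaced by its projection [p]. Since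
    [nA (x - p) = 0] and [B] is [A]-bounded, [B (x - p)] has seminorm zero. *)
Lemma normA_opnormA B : {morph B : x y / x - y} -> semi_bounded (dotA dot A) B ->
  forall x, nA (B x) <= opnormA dot A B * nA x.
Proof.
move=> BB [c c0 Bc] x; have [p Cp Ap] := range_projection dotP A_positive x.
have ker : nA (x - p) = 0.
  apply: ker_normA0; rewrite (linear_funB (positive_linear A_positive)) Ap subrr //.
have np : nA p <= nA x.
  rewrite -{1}(subKr x p) (le_trans (snormD aP _ _)) // (snormN aP).
  by rewrite [snorm _ (x - p)]ker addr0.
have nBx : nA (B x) <= nA (B p).
  rewrite -{1}(subrK (B p) (B x)) -BB (le_trans (snormD aP _ _)) //.
  by rewrite gerDr (le_trans (Bc _)) // [snorm _ _]ker mulr0.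
apply: le_trans nBx _; apply: le_trans _ (ler_wpM2l (opnormA_ge0 B) np).
have [p0|p0] := eqVneq (nA p) 0.
  by rewrite (le_trans (Bc _)) // [snorm _ p]p0 mulr0 mulr_ge0 ?opnormA_ge0 ?sqrtr_ge0.
have np0 : 0 < nA p by rewrite lt_def p0 sqrtr_ge0.
rewrite -ler_pdivrMr //; apply: ub_le_sup.
  exists c => _ [y _ <-]; have [y0|y0] := eqVneq (nA y) 0; first by rewrite y0 invr0 mulr0.
  by rewrite ler_pdivrMr ?Bc // lt_def y0 sqrtr_ge0.
exists p => //; split=> // /= p_eq0; move: p0; rewrite p_eq0 ker_normA0 ?eqxx //.
exact: linear_fun0 (positive_linear A_positive).
Qed.

Lemma numradiusA_ge0 B : 0 <= numradiusA dot A B.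
Proof. by apply: sup_nneg => _ [x _ <-]; apply: normc_ge0. Qed.

Lemma le_numradiusA B x : semi_bounded (dotA dot A) B -> nA x = 1 ->
  normc (dotA dot A (B x) x) <= numradiusA dot A B.
Proof.
move=> [c c0 Bc] x1; apply: ub_le_sup; last by exists x.
exists c => _ [y /= y1 <-]; rewrite (le_trans (Cauchy_Schwarz aP _ _)) //.
by rewrite [snorm _ y]y1 mulr1 (le_trans (Bc y)) // [snorm _ y]y1 mulr1.
Qed.

Lemma sharpA_bounded T : BA dot A T ->
  semi_bounded (dotA dot A) T /\ semi_bounded (dotA dot A) (sharpA dot A T).
Proof.
move=> T_BA; have XT := dotA_sharpA dotP A_positive T_BA.
have [/(bounded_operatorP dotP)[_ [x x0 Xx]] _] := sharpA_spec dotP A_positive T_BA.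
have [/(bounded_operatorP dotP)[_ [t t0 Tt]] _] := T_BA.
suff TB : semi_bounded (dotA dot A) T.
  by split=> //; apply: semi_adjoint_bounded XT TB.
(* The product [x * t] bounds the A-adjoint composed with [T] in the Hilbert norm; adding 1 gives
   [M > 0] for the growth lemma and [M <= M ^ 2] at the end. *)
pose M := x * t + 1; have M1 : 1 <= M by rewrite lerDr mulr_ge0.
exists M => [|y]; first lra.
have [K K0 AK] := normA_le_norm.
have : nA (sharpA dot A T (T y)) <= M * nA y.
  apply: (@symmetric_growth_bound _ _ _ aP (sharpA dot A T \o T) y (K * n y)).
  - by move=> u v /=; rewrite XT (semi_adjointC aP XT).
  - lra.
  move=> k; rewrite (le_trans (AK _)) // -mulrA ler_wpM2l //.
  elim: k => [|k IH]; first by rewrite mulr1.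
  rewrite iterS /= (le_trans (Xx _)) // exprS mulrCA.
  apply: le_trans _ (ler_wpM2l (_ : 0 <= M) IH); last lra.
  apply: le_trans (ler_wpM2l x0 (Tt _)) _; rewrite mulrA ler_wpM2r ?snorm_ge0 //.
  by rewrite lerDl.
move=> growth; rewrite -ler_sqr ?nnegrE ?mulr_ge0 ?sqrtr_ge0 //; last lra.
have := Re_semi_adjointl aP XT y; rewrite -[snorm _ _]/(nA _) => <-.
rewrite (le_trans (Re_le_normc _)) // (le_trans (Cauchy_Schwarz aP _ _)) //.
have ny : 0 <= nA y by exact: sqrtr_ge0.
apply: le_trans (ler_wpM2r ny growth) _; rewrite exprMn -mulrA -expr2.
by rewrite ler_wpM2r ?sqr_ge0 // expr2 ler_peMl //; lra.
Qed.

End SemiHilbertNorms.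

Theorem theorem2p11 (R : realType) (H : completeNormedModType R[i])
    (dot : {dot H for Num.conj}) (dotP : is_inner_product dot)
    (A : H -> H) (A_positive : positive_operator dot A)
    (T : H -> H) (T_BA : BA dot A T) :
  let w := numradiusA dot A in
  let N := opnormA dot A in
  let Ts := sharpA dot A T in
  let bound (alpha : R) : R :=
    alpha / 2 * w (T \o T)
    + N ((alpha / 4)%:C *: ((Ts \o T) + (T \o Ts)) + (1 - alpha)%:C *: (Ts \o T)) in
  (forall alpha : R, 0 <= alpha <= 1 ->
     alphanormA dot A alpha T ^+ 2 <= bound alpha) /\
  (exists m : R,
     [/\ is_minimum [set bound alpha | alpha in `[0, 1]] m,
         w T ^+ 2 <= m &
         m <= 1 / 2 * w (T \o T) + 1 / 4 * N ((Ts \o T) + (T \o Ts))]).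
Proof.
move=> w N Ts bound.
have aP := dotA_semi_inner dotP A_positive.
have XT : forall x y, dotA dot A (Ts x) y = dotA dot A x (T y).
  exact: dotA_sharpA.
have [Tbd Xbd] := sharpA_bounded dotP A_positive T_BA.
have TB : {morph T : x y / x - y} by apply: linear_funB; case: T_BA => -[].
have XB : {morph Ts : x y / x - y}.
  by apply: linear_funB; have [[]] := sharpA_spec dotP A_positive T_BA.
(* The operator inside [bound alpha] is [(alpha / 4) Q + (1 - alpha) P], affine in [alpha]. *)
pose Q := (Ts \o T) + (T \o Ts); pose P := Ts \o T.
have Pbd : semi_bounded (dotA dot A) P by exact: semi_bounded_comp.
have Qbd : semi_bounded (dotA dot A) Q.
  by apply: (semi_boundedD aP); exact: semi_bounded_comp.
have PB : {morph P : x y / x - y} by move=> x y; rewrite /P /= TB XB.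
have QB : {morph Q : x y / x - y}.
  by move=> x y; rewrite /Q !fctE /= !(TB, XB) opprD addrACA.
have combB (a b : R[i]) : {morph a *: Q + b *: P : x y / x - y}.
  by move=> x y; rewrite !fctE QB PB !scalerBr opprD addrACA.
have combbd (a b : R[i]) : semi_bounded (dotA dot A) (a *: Q + b *: P).
  by apply: (semi_boundedD aP); exact: (semi_boundedZ aP).
have bound_ge0 (alpha : R) : 0 <= alpha -> 0 <= bound alpha.
  by move=> a0; rewrite addr_ge0 ?opnormA_ge0 // mulr_ge0 ?numradiusA_ge0 // divr_ge0.
(* Weight [sqr_form_le] by [alpha] and add [(1 - alpha) |T x|_A^2]. Apart from the [T \o T] term,
   the result is the quadratic form at [x] of the operator [B] below, at most [N B] as
   [|x|_A = 1]. *)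
have pointwise (alpha : R) x : 0 <= alpha <= 1 -> normA dot A x = 1 ->
    alpha * normc (dotA dot A (T x) x) ^+ 2
      + (1 - alpha) * normA dot A (T x) ^+ 2 <= bound alpha.
  move=> /andP[a0 a1] x1.
  have := sqr_form_le aP XT x1.
  have : normc (dotA dot A (T (T x)) x) <= w (T \o T).
    exact: (le_numradiusA dotP A_positive (semi_bounded_comp Tbd Tbd)).
  set B : H -> H := (alpha / 4)%:C *: Q + (1 - alpha)%:C *: P.
  have NB : Re (dotA dot A (B x) x) <= N B.
    rewrite (le_trans (Re_le_normc _)) // (le_trans (Cauchy_Schwarz aP _ _)) //.
    rewrite [snorm _ x]x1 mulr1; apply: le_trans (normA_opnormA dotP A_positive _ _ x) _.
    - exact: combB.
    - exact: combbd.
    - by rewrite x1 mulr1.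
  have BE : Re (dotA dot A (B x) x) =
      alpha / 4 * (normA dot A (T x) ^+ 2 + normA dot A (Ts x) ^+ 2)
      + (1 - alpha) * normA dot A (T x) ^+ 2.
    rewrite /B !fctE (semiDl aP) !(semiZl aP) (semiDl aP) ReD !Re_realM ReD.
    by rewrite (Re_semi_adjointl aP XT) (Re_semi_adjointr aP XT).
  move: NB; rewrite BE /bound -/Q -/P -/B; move: (N B) (w _).
  rewrite -/(normA _ _ _) -/(normA _ _ (Ts x)) => b v.
  move: (_ ^+ 2) (_ ^+ 2) (_ ^+ 2) => p q r; nra.
have part1 (alpha : R) : 0 <= alpha <= 1 -> alphanormA dot A alpha T ^+ 2 <= bound alpha.
  move=> a01; have [a0 a1] := andP a01; rewrite -ler_sqrt ?bound_ge0 //.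
  rewrite sqrtr_sqr ger0_norm; last by apply: sup_nneg => _ [x _ <-]; exact: sqrtr_ge0.
  apply: sup_le_nneg => [|_ [x x1 <-]]; first exact: sqrtr_ge0.
  by rewrite ler_wsqrtr // pointwise.
split=> //.
have wT (alpha : R) : 0 <= alpha <= 1 -> w T ^+ 2 <= bound alpha.
  move=> a01; have [a0 a1] := andP a01; rewrite -ler_sqrt ?bound_ge0 //.
  rewrite sqrtr_sqr ger0_norm ?numradiusA_ge0 //.
  apply: sup_le_nneg => [|_ [x x1 <-]]; first exact: sqrtr_ge0.
  rewrite -[leLHS]ger0_norm ?normc_ge0 // -sqrtr_sqr ler_wsqrtr //.
  apply: le_trans (pointwise _ _ a01 x1).
  (* Hence [|<T x, x>_A|^2] is at most its convex combination with [|T x|_A^2], whatever [alpha]. *)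
  have : normc (dotA dot A (T x) x) ^+ 2 <= normA dot A (T x) ^+ 2.
    rewrite ler_sqr ?nnegrE ?normc_ge0 ?sqrtr_ge0 //.
    by apply: le_trans (Cauchy_Schwarz aP _ _) _; rewrite [snorm _ x]x1 mulr1.
  move: (_ ^+ 2) (_ ^+ 2) => p q; nra.
(* The operators at [x] and [y] differ by [(x - y) (Q / 4 - P)], which gives the second summand of
   the constant. *)
have lip (x y : R) : bound x <= bound y
    + (w (T \o T) / 2 + N ((1 / 4)%:C *: Q + (-1)%:C *: P)) * `|x - y|.
  have NN : N ((x / 4)%:C *: Q + (1 - x)%:C *: P) <=
      N ((y / 4)%:C *: Q + (1 - y)%:C *: P)
      + `|x - y| * N ((1 / 4)%:C *: Q + (-1)%:C *: P).
    apply: opnormA_le; first by rewrite addr_ge0 ?mulr_ge0 ?opnormA_ge0.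
    move=> z; rewrite mulrDl -mulrA.
    have -> : ((x / 4)%:C *: Q + (1 - x)%:C *: P) z =
        ((y / 4)%:C *: Q + (1 - y)%:C *: P) z
        + (x - y)%:C *: ((1 / 4)%:C *: Q + (-1)%:C *: P) z.
      rewrite !fctE; move: (Q z) (P z) => q p.
      rewrite scalerDr !scalerA addrACA -!scalerDl -!rmorphM -!rmorphD.
      by congr (_%:C *: _ + _%:C *: _); field.
    apply: le_trans (snormD aP _ _) _; rewrite (snormZ aP) normc_real.
    apply: lerD; first exact: normA_opnormA (combB _ _) (combbd _ _) z.
    by rewrite ler_wpM2l //; exact: normA_opnormA (combB _ _) (combbd _ _) z.
  have := ler_wpM2r (numradiusA_ge0 dot A (T \o T)) (ler_norm (x - y)).
  move: NN; rewrite /bound -/w -/Q -/P.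
  move: (N _) (N _) (N _) (w _) => u1 u2 u3 v; lra.
have [c c01 cmin] := lipschitz_min ler01 lip.
exists (bound c); split; last 1 first.
(* At [alpha = 1] the [P] term vanishes and the bound becomes the right-hand side of (ii). *)
- apply: le_trans (cmin 1 _) _; first by rewrite ler01 lexx.
  rewrite lerD2l; apply: opnormA_le; first by rewrite mulr_ge0 ?divr_ge0 ?opnormA_ge0.
  move=> x; rewrite subrr scale0r addr0 !fctE.
  apply: le_trans (_ : normc (1 / 4)%:C * normA dot A (Q x) <= _).
    by rewrite -(snormZ aP).
  rewrite normc_real ger0_norm ?divr_ge0 // -[leRHS]mulrA ler_wpM2l ?divr_ge0 //.
  exact: normA_opnormA.
- split; first by exists c => //=; rewrite in_itv.
  by move=> _ [t /= t01 <-]; apply: cmin; rewrite in_itv in t01.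
exact: wT.
Qed.
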